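(* Let $k$ be an algebraically closed field of characteristic $0$, let $f=(f_1,\ldots,f_n)\colon\mathbb{A}^n_k\to\mathbb{A}^n_k$ be a polynomial morphism, and let $q\in\mathbb{A}^n_k(k)$. If $\mathrm{Jac}(f)\in k^\times$ and $f$ is injective at $q$ (i.e. $|f^{-1}(q)|\leq 1$), then the reduced Bézoutian $\overline{\mathrm{B\acute ez}}(f-q)$ is constant.
   Context: Write $\mathbf{x}=(x_1,\ldots,x_n)$, $\mathbf{y}=(y_1,\ldots,y_n)$. A polynomial morphism $f\colon\mathbb{A}^n_k\to\mathbb{A}^n_k$ is given by polynomials $f_1,\ldots,f_n\in k[\mathbf{x}]$; for $q=(q_1,\ldots,q_n)\in k^n$, $f-q$ denotes $(f_1-q_1,\ldots,f_n-q_n)$. $\mathrm{Jac}(f):=\det(\partial f_i/\partial x_j)$. The fiber $f^{-1}(q)$ is the set of points of the closed subscheme $\mathbb{V}(f-q)\subseteq\mathbb{A}^n_k$ cut out by $f_1-q_1,\ldots,f_n-q_n$. The (multivariate) Bézoutian of $f$ is the determinant $\mathrm{B\acute ez}(f):=\det(\Delta_{ij})\in k[\mathbf{x},\mathbf{y}]$, where $$\Delta_{ij}=\frac{f_i(y_1,\ldots,y_{j-1},x_j,\ldots,x_n)-f_i(y_1,\ldots,y_j,x_{j+1},\ldots,x_n)}{x_j-y_j}.$$ The reduced Bézoutian $\overline{\mathrm{B\acute ez}}(f)$ is the class of $\mathrm{B\acute ez}(f)$ in $k[\mathbf{x},\mathbf{y}]/(f(\mathbf{x}),f(\mathbf{y}))$,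 where $(f(\mathbf{x}),f(\mathbf{y}))$ is the ideal generated by $f_1(\mathbf{x}),\ldots,f_n(\mathbf{x}),f_1(\mathbf{y}),\ldots,f_n(\mathbf{y})$. Thus $\overline{\mathrm{B\acute ez}}(f-q)$ is the class of $\mathrm{B\acute ez}(f-q)$ in $k[\mathbf{x},\mathbf{y}]/(f(\mathbf{x})-q,f(\mathbf{y})-q)$. For a polynomial ring $R$ over $k$ and an ideal $I\subseteq R$, an element $c\in R/I$ is called constant if (i) $I$ is a proper ideal and $c\in k\subseteq R/I$, or (ii) $I$ is not proper, in which case $c=0$. *)

(* Defs.v *)
From HB Require Import structures.
From mathcomp Require Import all_boot all_order all_algebra.
From mathcomp Require Export generic_quotient ring_quotient.
From mathcomp Require Import boolp.
From mathcomp Require Export mpoly.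

Set Implicit Arguments.
Unset Strict Implicit.
Unset Printing Implicit Defensive.

Import GRing.Theory.
Local Open Scope ring_scope.
Local Open Scope quotient_scope.

Section GeneratedIdeal.
Variable R : comNzRingType.
Implicit Type s : seq R.

Definition ideal_gen s : {pred R} :=
  fun p => `[< exists c : 'I_(size s) -> R, p = \sum_i c i * s`_i >].

Lemma ideal_genP s p :
  reflect (exists c : 'I_(size s) -> R, p = \sum_i c i * s`_i)
          (p \in ideal_gen s).
Proof. exact: asboolP. Qed.

Lemma ideal_gen_zmod_closed s : zmod_closed (ideal_gen s).
Proof.
split=> [|p q /ideal_genP[c ->] /ideal_genP[d ->]]; apply/ideal_genP.
  by exists (fun=> 0); rewrite big1 // => i _; rewrite mul0r.
exists (fun i => c i - d i); rewrite -sumrB.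
by apply: eq_bigr => i _; rewrite mulrBl.
Qed.

HB.instance Definition _ s :=
  GRing.isZmodClosed.Build R (ideal_gen s) (ideal_gen_zmod_closed s).

Lemma ideal_genM s a p : p \in ideal_gen s -> a * p \in ideal_gen s.
Proof.
move=> /ideal_genP[c ->]; apply/ideal_genP; exists (fun i => a * c i).
by rewrite mulr_sumr; apply: eq_bigr => i _; rewrite mulrA.
Qed.

Lemma mem_ideal_gen s p : p \in s -> p \in ideal_gen s.
Proof.
move=> sp; apply/ideal_genP; have lt_i : (index p s < size s)%N by rewrite index_mem.
exists (fun j => (j == Ordinal lt_i)%:R).
rewrite (bigD1 (Ordinal lt_i)) //= eqxx mul1r nth_index // big1 ?addr0 //.
by move=> j /negPf->; rewrite mul0r.
Qed.

End GeneratedIdeal.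

(* [{ideal_quot I}] is the library's quotient of the additive group. It is used
   instead of its ring structure because the latter only exists for proper
   ideals, whereas [I] may be the unit ideal here. *)
Definition is_constant (k : fieldType) (m : nat) (I : zmodClosed {mpoly k[m]})
    (c : {ideal_quot I}) : Prop :=
  (1 \notin I /\ exists a : k, c = \pi_{ideal_quot I} a%:MP) \/ (1 \in I /\ c = 0).

Section Bezoutian.
Variables (k : fieldType) (n : nat).
Implicit Types (f : n.-tuple {mpoly k[n]}) (q : n.-tuple k).

Definition sub_point f q : n.-tuple {mpoly k[n]} :=
  [tuple tnth f i - (tnth q i)%:MP | i < n].

Definition jacobian f : {mpoly k[n]} :=
  \det (\matrix_(i < n, j < n) (tnth f i)^`M(j)).

(* A point of the scheme V(f - q) is a prime ideal of k[x] that contains all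
   the f_i - q_i. The library's [prime_idealr] is a boolean predicate, which
   classically excludes no prime ideal. *)
Definition in_fiber f q (P : prime_idealr {mpoly k[n]}) : Prop :=
  forall i, tnth (sub_point f q) i \in P.

Definition injective_at f q : Prop :=
  forall P P' : prime_idealr {mpoly k[n]},
    in_fiber f q P -> in_fiber f q P' -> P =i P'.

(* In k[x, y] = {mpoly k[n + n]}, the x_j are the first n variables and the
   y_j the last n ones. *)
Definition varx (j : 'I_n) : {mpoly k[n + n]} := 'X_(lshift n j).
Definition vary (j : 'I_n) : {mpoly k[n + n]} := 'X_(rshift n j).

(* The list y_0, ..., y_(m-1), x_m, ..., x_(n-1), with indices starting at 0;
   it is x for m = 0 and y for m = n. *)
Definition mixed (m : nat) : n.-tuple {mpoly k[n + n]} :=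
  [tuple if (l < m)%N then vary l else varx l | l < n].

Lemma diff_dvd (p : {mpoly k[n]}) (u v : n.-tuple {mpoly k[n + n]}) (j : 'I_n) :
  (forall l, l != j -> tnth u l = tnth v l) ->
  exists d, d * (tnth u j - tnth v j) = (p \mPo u) - (p \mPo v).
Proof.
move=> uv; elim/mpolyind: p => [|c m p _ _ [d IHd]].
  by exists 0; rewrite !comp_mpoly0 mul0r subrr.
have [e eP] : exists e, e * (tnth u j - tnth v j) =
      ('X_[m] \mPo u) - ('X_[m] \mPo v).
  rewrite !comp_mpolyX !(bigD1 (P := predT) j) //=.
  rewrite (eq_bigr (fun i => tnth v i ^+ m i)) => [|i /uv->//].
  by rewrite -mulrBl subrXX -mulrA mulrC; eexists.
exists (c *: e + d).
by rewrite mulrDl IHd -scalerAl eP !comp_mpolyD !comp_mpolyZ scalerBr addrACA opprD.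
Qed.

Lemma bez_quot_ex f (i j : 'I_n) : exists d : {mpoly k[n + n]},
  d * (varx j - vary j) ==
    (tnth f i \mPo mixed j) - (tnth f i \mPo mixed j.+1).
Proof.
have [|d dP] := @diff_dvd (tnth f i) (mixed j) (mixed j.+1) j.
  move=> l neq_lj; rewrite !tnth_mktuple [in RHS]ltnS.
  by rewrite [in RHS]leq_eqVlt (inj_eq val_inj) (negPf neq_lj).
by exists d; rewrite -dP !tnth_mktuple ltnn ltnSn.
Qed.

Definition bez_quot f (i j : 'I_n) : {mpoly k[n + n]} :=
  xchoose (bez_quot_ex f i j).

Lemma bez_quotP f i j :
  bez_quot f i j * (varx j - vary j) =
    (tnth f i \mPo mixed j) - (tnth f i \mPo mixed j.+1).
Proof. exact/eqP/(xchooseP (bez_quot_ex f i j)). Qed.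

Lemma bez_quot_unique f i j (d : {mpoly k[n + n]}) :
  d * (varx j - vary j) =
    (tnth f i \mPo mixed j) - (tnth f i \mPo mixed j.+1) ->
  d = bez_quot f i j.
Proof.
rewrite -bez_quotP; apply: mulIf; rewrite subr_eq0; apply/eqP => eq_xy.
have := congr1 (mcoeff U_(lshift n j)%MM) eq_xy.
by rewrite !mcoeffX eqxx eq_mnm1 eq_rlshift => /eqP; rewrite oner_eq0.
Qed.

Definition bezoutian f : {mpoly k[n + n]} :=
  \det (\matrix_(i < n, j < n) bez_quot f i j).

Definition bez_ideal f : zmodClosed {mpoly k[n + n]} :=
  ideal_gen ([seq p \mPo [tuple varx j | j < n] | p <- f] ++
             [seq p \mPo [tuple vary j | j < n] | p <- f]).

Definition reduced_bezoutian f : {ideal_quot (bez_ideal f)} :=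
  \pi_{ideal_quot (bez_ideal f)} (bezoutian f).

End Bezoutian.

(* Main.v *)
(* Write g = f - q, B = Bez(g), and c = Jac(f). By Cramer's rule B annihilates
   all x_j - y_j modulo the ideal I = (g(x), g(y)), and on the diagonal B equals
   c; hence B(B - c) is in I, so B/c is an idempotent of R (x) R, where R = k[x]/(g).
   An element of R (x) R that is killed by the x_j - y_j and restricts to a unit
   on the diagonal forces R to be finite over k: in a shortest expression
   B = sum_l a_l (x) b_l the b_l are linearly independent, and contracting
   x_j B = y_j B with the dual functionals shows that each x_j acts on the column
   (a_l) through a scalar matrix, whose characteristic polynomial kills x_j in R.
   A proper ideal over an algebraically closed field that contains a monic
   polynomial in each variable has a zero, found one coordinate at a time.
   If I + (B) were proper it would have a zero (a, b) with g(a) = g(b) = 0, so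
   a = b by injectivity and B(a, a) = c <> 0, which is absurd. Thus 1 = i + r B
   with i in I, and multiplying by B - c gives B = c modulo I. *)
Require Import Defs.
From HB Require Import structures.
From mathcomp Require Import all_boot all_order all_algebra.
From mathcomp Require Import boolp.
From mathcomp Require classical_sets.
From mathcomp Require Import mpoly ring.

Set Implicit Arguments.
Unset Strict Implicit.
Unset Printing Implicit Defensive.

Import GRing.Theory.
Local Open Scope ring_scope.

(** * Finitely generated ideals and Cramer's rule *)

Lemma ideal_gen_morph (R S : comNzRingType) (phi : {rmorphism R -> S})
    (s : seq R) (t : seq S) p :
  (forall x, x \in s -> phi x \in ideal_gen t) ->
  p \in ideal_gen s -> phi p \in ideal_gen t.
Proof.
move=> st /ideal_genP[c ->]; rewrite rmorph_sum rpred_sum // => i _.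
by rewrite rmorphM ideal_genM // st // mem_nth.
Qed.

Lemma ideal_gen_subset (R : comNzRingType) (s t : seq R) p :
  {subset s <= t} -> p \in ideal_gen s -> p \in ideal_gen t.
Proof. by move=> st; apply: (@ideal_gen_morph _ _ idfun) => x /st/mem_ideal_gen. Qed.

Lemma ideal_gen_consP (R : comNzRingType) (s : seq R) z p :
  p \in ideal_gen (z :: s) <-> exists c, p - c * z \in ideal_gen s.
Proof.
split=> [/ideal_genP[c ->]|[c pcz]].
  exists (c ord0); rewrite big_ord_recl /= addrC addKr.
  by apply/ideal_genP; exists (fun i => c (lift ord0 i)).
rewrite -(subrK (c * z) p) rpredD //.
  by apply: ideal_gen_subset pcz => x sx; rewrite inE sx orbT.
by rewrite ideal_genM // mem_ideal_gen ?mem_head.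
Qed.

(** If every z in [zs] became a unit modulo [s], each would satisfy 1 - c z in (s) for some c. The
    factors of the product could then be cancelled one at a time, until the empty product 1 lay in
    (s). *)
Lemma ideal_gen_prod_split (R : comNzRingType) (s zs : seq R) :
  1 \notin ideal_gen s -> \prod_(z <- zs) z \in ideal_gen s ->
  exists2 z, z \in zs & 1 \notin ideal_gen (z :: s).
Proof.
move=> s1 zs_s; apply: contrapT => no_z; move/negP: s1; apply.
have {no_z} unit_z z : z \in zs -> 1 \in ideal_gen (z :: s).
  by move=> zzs; apply/negPn/negP => z1; apply: no_z; exists z.
elim: zs zs_s unit_z => [|z zs IHzs]; first by rewrite big_nil.
rewrite big_cons => zzs_s unit_z; apply: IHzs; last first.
  by move=> y yzs; rewrite unit_z // inE yzs orbT.
have /ideal_gen_consP[c c1] := unit_z z (mem_head _ _).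
have -> : \prod_(y <- zs) y =
    (\prod_(y <- zs) y) * (1 - c * z) + c * (z * \prod_(y <- zs) y) by ring.
by rewrite rpredD // ideal_genM.
Qed.

(** Coordinate j of adj(D) D w = det(D) w. It serves to conclude that det(D) w_j lies in an ideal as
    soon as all entries of D w do. *)
Lemma adj_mul_col (R : comNzRingType) n (D : 'M[R]_n) (w : 'I_n -> R) j :
  \sum_i (\adj D) j i * (\sum_l D i l * w l) = \det D * w j.
Proof.
have := congr1 (fun M : 'M_n => (M *m \col_l w l) j ord0) (mul_adj_mx D).
rewrite -mulmxA mul_scalar_mx [LHS]mxE [RHS]mxE [in RHS]mxE => <-.
apply: eq_bigr => i _; rewrite [in RHS](mxE _ _ i).
by congr (_ * _); apply: eq_bigr => l _; rewrite mxE.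
Qed.

(** * Ring induction on polynomials, substitution and the chain rule *)

Lemma mpoly_ring_ind n (R : comNzRingType) (P : {mpoly R[n]} -> Prop) :
    (forall c, P c%:MP) -> (forall i, P 'X_i) ->
    (forall p q, P p -> P q -> P (p + q)) ->
    (forall p q, P p -> P q -> P (p * q)) ->
  forall p, P p.
Proof.
move=> PC PX PD PM; elim/mpolyind => [|c m p _ _ Pp].
  by rewrite -(mpolyC0 n R); exact: PC.
apply: PD (Pp); rewrite -mul_mpolyC; apply: (PM _ _ (PC c)).
rewrite mpolyXE_id; apply: (big_ind P) => [||i _]; last 1 first.
- by elim: (m i) => [|e Pe]; [exact: PC | rewrite exprS; exact: PM].
- exact: PC.
- exact: PM.
Qed.

(** The polynomials p with this property contain the constants and the variables, and are closed
    under sums and products. The factor b is 1 for congruences modulo the ideal, and the Bezoutian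
    where only its multiples of differences lie there. *)
Lemma comp_mpoly_congr (R : comNzRingType) n m (s : seq {mpoly R[m]}) b
    (u v : n.-tuple {mpoly R[m]}) :
  (forall j, b * (tnth u j - tnth v j) \in ideal_gen s) ->
  forall p, b * ((p \mPo u) - (p \mPo v)) \in ideal_gen s.
Proof.
move=> uv; elim/mpoly_ring_ind => [c|i|p q Pp Pq|p q Pp Pq].
- by rewrite !comp_mpolyC subrr mulr0 rpred0.
- by rewrite !comp_mpolyXU -!tnth_nth.
- rewrite !comp_mpolyD opprD addrACA mulrDr; exact: rpredD.
rewrite !rmorphM /=; move: (p \mPo u) (q \mPo u) (p \mPo v) (q \mPo v) Pp Pq.
move=> pu qu pv qv Pp Pq.
have -> : b * (pu * qu - pv * qv) = pu * (b * (qu - qv)) + qv * (b * (pu - pv)).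
  by ring.
by apply: rpredD; exact: ideal_genM.
Qed.

Lemma comp_mpolyA (R : comNzRingType) n m l (u : n.-tuple {mpoly R[m]})
    (v : m.-tuple {mpoly R[l]}) p :
  (p \mPo u) \mPo v = p \mPo [tuple tnth u i \mPo v | i < n].
Proof.
elim/mpoly_ring_ind: p => [c|i|p q Pp Pq|p q Pp Pq].
- by rewrite !comp_mpolyC.
- by rewrite !comp_mpolyXU -!tnth_nth tnth_mktuple.
- by rewrite !comp_mpolyD Pp Pq.
by rewrite !rmorphM /= Pp Pq.
Qed.

Lemma mderivXU (R : comNzRingType) n (i l : 'I_n) :
  ('X_i : {mpoly R[n]})^`M(l) = (i == l)%:R.
Proof.
rewrite mderivX mnm1E; case: eqP => [->|_]; last by rewrite scale0r.
by rewrite scale1r -mpolyX0; congr 'X_[_]; apply/mnmP => e; rewrite mnmBE subnn mnm0E.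
Qed.

Lemma mderiv_comp (R : comNzRingType) n m (u : n.-tuple {mpoly R[m]}) j p :
  (p \mPo u)^`M(j) = \sum_(l < n) (p^`M(l) \mPo u) * (tnth u l)^`M(j).
Proof.
elim/mpoly_ring_ind: p => [c|i|p q Pp Pq|p q Pp Pq].
- rewrite comp_mpolyC mderivC big1 // => l _.
  by rewrite mderivC comp_mpoly0 mul0r.
- rewrite comp_mpolyXU -tnth_nth (bigD1 i) //= mderivXU eqxx rmorph1 mul1r.
  by rewrite big1 ?addr0 // => l /negPf li; rewrite mderivXU eq_sym li rmorph0 mul0r.
- rewrite comp_mpolyD mderivD Pp Pq -big_split /=; apply: eq_bigr => l _.
  by rewrite mderivD comp_mpolyD mulrDl.
rewrite rmorphM /= mderivM Pp Pq mulr_suml mulr_sumr -big_split /=.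
by apply: eq_bigr => l _; rewrite mderivM rmorphD !rmorphM /=; ring.
Qed.

(** * Linear maps on polynomials and separating functionals *)

Lemma linear_extension (R : comNzRingType) n (V : lmodType R)
    (psi : 'X_{1..n} -> V) :
  exists L : {linear {mpoly R[n]} -> V}, forall m, L 'X_[m] = psi m.
Proof.
pose L (p : {mpoly R[n]}) := \sum_(m <- msupp p) p@_m *: psi m.
(* Linearity is checked by summing over an index set that does not depend on p, namely all monomials
   below a common degree bound. *)
have LE d p : (msize p <= d)%N ->
    L p = \sum_(m : 'X_{1..n < d}) p@_m *: psi m.
  move=> le_pd; rewrite /L (ssrcomplements.big_mksub ('X_{1..n < d} : subFinType _)) ?msupp_uniq //=.
    by rewrite big_rmcond //= => m /memN_msupp_eq0 ->; rewrite scale0r.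
  by move=> m /msize_mdeg_lt /leq_trans; apply.
have L_lin : linear L.
  move=> a p q; pose d := maxn (msize (a *: p + q)) (maxn (msize p) (msize q)).
  rewrite !(LE d) ?leq_max ?leqnn ?orbT // scaler_sumr -big_split /=.
  by apply: eq_bigr => m _; rewrite mcoeffD mcoeffZ scalerDl scalerA.
pose HL := GRing.isLinear.Build R {mpoly R[n]} V _ L L_lin.
pose L' : {linear {mpoly R[n]} -> V} := HB.pack L HL.
by exists L' => m; rewrite /= /L msuppX big_seq1 mcoeffX eqxx scale1r.
Qed.

(** By Zorn's lemma there is a subspace A that contains W and is maximal among those avoiding v.
    Then A and v span V, and the functional reads off the coefficient of v modulo A. *)
Lemma separating_functional (k : fieldType) (V : lmodType k) (W : V -> Prop) v :
    W 0 -> (forall a x y, W x -> W y -> W (a *: x + y)) -> ~ W v ->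
  exists phi : {scalar V}, (forall x, W x -> phi x = 0) /\ phi v = 1.
Proof.
move=> W0 Wlin Wv.
(* Containing W is required only of nonempty sets, so that the union of the empty chain satisfies P.
   A maximal A is not empty, since W itself would be larger. *)
pose P (A : V -> Prop) := [/\ forall x, A x -> (forall y, W y -> A y),
  forall a x y, A x -> A y -> A (a *: x + y) & ~ A v].
have [F FP Ftot|A [[AW Alin Av] Amax]] := @classical_sets.Zorn_bigcup V P.
  split.
  - by move=> x [B FB Bx] y Wy; exists B => //; case: (FP _ FB) => + _ _; apply; eassumption.
  - move=> a x y [B FB Bx] [C FC Cy].
    have [BC|CB] := Ftot _ _ FB FC.
      by exists C => //; case: (FP _ FC) => _ + _; apply=> //; apply: BC.
    by exists B => //; case: (FP _ FB) => _ + _; apply=> //; apply: CB.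
  - by move=> [B FB Bv]; case: (FP _ FB).
have {}AW y : W y -> A y.
  move=> Wy; have [[x Ax]|noA] := pselect (exists x, A x); first exact: AW Ax _ Wy.
  exfalso; apply: (Amax W); last by split.
  by split=> [x Ax|/(_ _ W0) A0]; case: noA; [exists x | exists 0].
have A0 := AW _ W0.
have AZ a x : A x -> A (a *: x) by move=> Ax; rewrite -[_ *: _]addr0; apply: Alin.
have AB x y : A x -> A y -> A (x - y).
  by move=> Ax Ay; rewrite addrC -scaleN1r; apply: Alin.
have Auniq a b p : A (p - a *: v) -> A (p - b *: v) -> a = b.
  move=> Aa Ab; apply/eqP; rewrite -subr_eq0; apply/negPn/negP => ab0; apply: Av.
  rewrite -(scale1r v) -(mulVf ab0) -scalerA; apply: AZ.
  by have := AB _ _ Ab Aa; rewrite opprB addrC addrA subrK scalerBl.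
have ex_c p : exists c, A (p - c *: v).
  have [Ap|nAp] := pselect (A p); first by exists 0; rewrite scale0r subr0.
  (* B is A + k p. Maximality of A forces v into B, say v - c p in A; here c is nonzero because v is
     not in A, so p is congruent to c^-1 v modulo A. *)
  pose B x := exists2 c, A (x - c *: p) & True.
  have AsubB x : A x -> B x by exists 0; rewrite // scale0r subr0.
  have [PB|nPB] := pselect (P B).
    exfalso; apply: (Amax B) => //; split=> // /(_ p) Bp; apply/nAp/Bp.
    by exists 1; rewrite // scale1r subrr.
  have [c Ac _] : B v.
    apply: contrapT => nBv; apply: nPB; split=> //.
      by move=> x _ y /AW/AsubB.
    move=> a x y [c Ac _] [d Ad _]; exists (a * c + d) => //.
    rewrite scalerDl opprD addrACA -scalerA -scalerBr; exact: Alin.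
  have c0 : c != 0 by apply/eqP => c0; apply: Av; rewrite c0 scale0r subr0 in Ac.
  exists c^-1; have := AZ (- c^-1) _ Ac.
  by rewrite scalerBr scalerA mulNr mulVf // !scaleNr scale1r opprK addrC.
pose phi p := sval (cid (ex_c p)).
have phiP p : A (p - phi p *: v) by rewrite /phi; case: cid.
have phi_lin : linear_for *%R phi.
  move=> a x y; apply: Auniq (phiP _) _.
  rewrite scalerDl opprD addrACA -scalerA -scalerBr; exact: Alin.
pose Hphi := GRing.isLinear.Build k V k *%R phi phi_lin.
pose phi' : {scalar V} := HB.pack phi Hphi.
exists phi'; split=> [x Wx|]; apply: Auniq (phiP _) _.
  by rewrite scale0r subr0; apply: AW.
by rewrite scale1r subrr.
Qed.

(** * The ring k[x, y] as the tensor square of k[x] *)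

Section TwoCopies.
Variables (k : fieldType) (n : nat).
Implicit Types (u v : {mpoly k[n]}) (h : {mpoly k[n + n]}) (s : seq {mpoly k[n]}).

Definition inx : {mpoly k[n]} -> {mpoly k[n + n]} :=
  comp_mpoly [tuple varx k j | j < n].
Definition iny : {mpoly k[n]} -> {mpoly k[n + n]} :=
  comp_mpoly [tuple vary k j | j < n].
HB.instance Definition _ := GRing.LRMorphism.on inx.
HB.instance Definition _ := GRing.LRMorphism.on iny.

(** Restriction to the diagonal x = y, that is, the multiplication map k[x] (x) k[x] -> k[x]. *)
Definition diag : {mpoly k[n + n]} -> {mpoly k[n]} :=
  comp_mpoly [tuple 'X_(match split i with inl j => j | inr j => j end) | i < n + n].
HB.instance Definition _ := GRing.LRMorphism.on diag.

(** The kernel of k[x] (x) k[x] -> R (x) R for R = k[x]/(s). For the list of components of a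
    morphism it is convertible to [bez_ideal]. *)
Definition double_ideal s := ideal_gen (map inx s ++ map iny s).

Lemma inx_X j : inx 'X_j = varx k j.
Proof. by rewrite /inx comp_mpolyXU -tnth_nth tnth_mktuple. Qed.

Lemma iny_X j : iny 'X_j = vary k j.
Proof. by rewrite /iny comp_mpolyXU -tnth_nth tnth_mktuple. Qed.

Lemma diag_varx j : diag (varx k j) = 'X_j.
Proof. by rewrite /diag comp_mpolyXU -tnth_nth tnth_mktuple (unsplitK (inl j)). Qed.

Lemma diag_vary j : diag (vary k j) = 'X_j.
Proof. by rewrite /diag comp_mpolyXU -tnth_nth tnth_mktuple (unsplitK (inr j)). Qed.

Lemma diag_inx : cancel inx diag.
Proof.
move=> u; rewrite /diag comp_mpolyA -[RHS]comp_mpoly_id.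
by congr (_ \mPo _); apply: eq_from_tnth => j; rewrite !tnth_mktuple; exact: diag_varx.
Qed.

Lemma diag_iny : cancel iny diag.
Proof.
move=> u; rewrite /diag comp_mpolyA -[RHS]comp_mpoly_id.
by congr (_ \mPo _); apply: eq_from_tnth => j; rewrite !tnth_mktuple; exact: diag_vary.
Qed.

(** Writes h(x, y) -> h(y, y) as a single substitution, the form to which [comp_mpoly_congr]
    applies. *)
Lemma iny_diag h : iny (diag h) = h \mPo [tuple iny (diag 'X_i) | i < n + n].
Proof.
elim/mpoly_ring_ind: h => [c|i|p q Pp Pq|p q Pp Pq].
- by rewrite [diag _]comp_mpolyC [LHS]comp_mpolyC comp_mpolyC.
- by rewrite comp_mpolyXU -tnth_nth tnth_mktuple.
- by rewrite [diag _]comp_mpolyD [LHS]comp_mpolyD comp_mpolyD -Pp -Pq.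
by rewrite !rmorphM /= -Pp -Pq.
Qed.

Lemma inx_double s u : u \in ideal_gen s -> inx u \in double_ideal s.
Proof.
apply: ideal_gen_morph => p sp; apply: mem_ideal_gen.
by rewrite mem_cat (map_f _ sp).
Qed.

Lemma iny_double s u : u \in ideal_gen s -> iny u \in double_ideal s.
Proof.
apply: ideal_gen_morph => p sp; apply: mem_ideal_gen.
by rewrite mem_cat (map_f (@iny) sp) orbT.
Qed.

Lemma diag_double s h : h \in double_ideal s -> diag h \in ideal_gen s.
Proof.
apply: ideal_gen_morph => p; rewrite mem_cat => /orP[] /mapP[u us ->].
  by rewrite /= diag_inx mem_ideal_gen.
by rewrite /= diag_iny mem_ideal_gen.
Qed.

Lemma tensor_ind (P : {mpoly k[n + n]} -> Prop) :
    (forall u v, P (inx u * iny v)) ->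
    (forall p q, P p -> P q -> P (p + q)) ->
  forall h, P h.
Proof.
move=> PT PD; elim/mpolyind => [|c m p _ _ Pp].
  by have := PT 0 0; rewrite rmorph0 mul0r.
apply: PD (Pp); rewrite mpolyXE_id big_split_ord /=.
have := PT (c *: \prod_i 'X_i ^+ m (lshift n i)) (\prod_i 'X_i ^+ m (rshift n i)).
rewrite linearZ /= -scalerAl !rmorph_prod /=.
under eq_bigr => i _ do rewrite rmorphXn /= inx_X.
by under [X in _ * X]eq_bigr => i _ do rewrite rmorphXn /= iny_X.
Qed.

Lemma tensor_sum h : exists r (a b : 'I_r -> {mpoly k[n]}),
  h = \sum_l inx (a l) * iny (b l).
Proof.
elim/tensor_ind: h => [u v|p q [r [a [b ->]]] [t [c [d ->]]]].
  by exists 1%N, (fun=> u), (fun=> v); rewrite big_ord1.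
pose glue (f : 'I_r -> {mpoly k[n]}) (g : 'I_t -> {mpoly k[n]}) i :=
  match split i with inl j => f j | inr j => g j end.
exists (r + t)%N, (glue a c), (glue b d); rewrite big_split_ord /glue.
congr +%R; apply: eq_bigr => i _; first by rewrite (unsplitK (inl i)).
by rewrite (unsplitK (inr i)).
Qed.

(** [Phi] is the contraction id (x) phi, defined on monomials and extended linearly. On a multiple
    of a generator in x that generator stays as a factor of the result; on a multiple of a generator
    in y the value of phi is 0. *)
Lemma slice s (phi : {scalar {mpoly k[n]}}) :
    (forall v, v \in ideal_gen s -> phi v = 0) ->
  exists Phi : {linear {mpoly k[n + n]} -> {mpoly k[n]}},
    (forall u v, Phi (inx u * iny v) = phi v *: u) /\
    (forall h, h \in double_ideal s -> Phi h \in ideal_gen s).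
Proof.
move=> phi0.
pose psi (m : 'X_{1..n + n}) : {mpoly k[n]} :=
  phi (\prod_i 'X_i ^+ m (rshift n i)) *: (\prod_i 'X_i ^+ m (lshift n i)).
have [Phi PhiX] := linear_extension psi.
have PhiXX m1 m2 : Phi (inx 'X_[m1] * iny 'X_[m2]) = phi 'X_[m2] *: 'X_[m1].
  pose m : 'X_{1..n + n} :=
    [multinom match split i with inl j => m1 j | inr j => m2 j end | i < n + n].
  have ml i : m (lshift n i) = m1 i by rewrite mnmE (unsplitK (inl i)).
  have mr i : m (rshift n i) = m2 i by rewrite mnmE (unsplitK (inr i)).
  have -> : inx 'X_[m1] * iny 'X_[m2] = 'X_[m].
    rewrite [in RHS]mpolyXE_id big_split_ord /= ![in LHS]mpolyXE_id !rmorph_prod /=.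
    by congr (_ * _); apply: eq_bigr => i _; rewrite rmorphXn /= ?inx_X ?iny_X ?ml ?mr.
  rewrite PhiX /psi [in RHS](mpolyXE_id _ m1) [in RHS](mpolyXE_id _ m2).
  by congr (phi _ *: _); apply: eq_bigr => i _; rewrite ?ml ?mr.
have PhiT u v : Phi (inx u * iny v) = phi v *: u.
  rewrite (mpolyE u) (mpolyE v) !linear_sum /= mulr_suml linear_sum.
  apply: eq_bigr => m1 _; rewrite mulr_sumr linear_sum scaler_suml.
  apply: eq_bigr => m2 _; rewrite !linearZ /= -scalerAl -scalerAr !linearZ /= PhiXX.
  by rewrite !scalerA; congr (_ *: _); ring.
exists Phi; split=> // _ /ideal_genP[c ->]; rewrite linear_sum rpred_sum //= => i _.
set z := (X in c i * X); have : z \in map inx s ++ map iny s by rewrite mem_nth.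
move: (c i) z => {c i} c z; rewrite mem_cat => /orP[] /mapP[p sp ->].
  elim/tensor_ind: c => [u v|h h' IH IH'].
    rewrite mulrAC -rmorphM PhiT -mul_mpolyC ideal_genM // ideal_genM //.
    exact: mem_ideal_gen.
  by rewrite mulrDl linearD rpredD.
elim/tensor_ind: c => [u v|h h' IH IH'].
  by rewrite -mulrA -rmorphM PhiT phi0 ?scale0r ?rpred0 // ideal_genM // mem_ideal_gen.
by rewrite mulrDl linearD rpredD.
Qed.

End TwoCopies.

(** * Algebraicity of the variables and zeros of proper ideals *)

Section Finite.
Variables (k : fieldType) (n : nat) (s : seq {mpoly k[n]}).
Implicit Types (h : {mpoly k[n + n]}).

(** Take an expression with the least number r of terms. A relation modulo (s) in which b_l has
    coefficient 1 would express b_l through the other b_i, and absorbing it into their terms would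
    leave r - 1 terms. *)
Lemma reduced_tensor h : exists r (a b : 'I_r -> {mpoly k[n]}),
  h - \sum_l inx (a l) * iny (b l) \in double_ideal s /\
  forall (c : 'I_r -> k) l, c l = 1 -> \sum_i c i *: b i \notin ideal_gen s.
Proof.
pose Q r := `[< exists a b : 'I_r -> {mpoly k[n]},
  h - \sum_l inx (a l) * iny (b l) \in double_ideal s >].
have exQ : exists r, Q r.
  have [r [a [b hE]]] := tensor_sum h.
  by exists r; apply/asboolP; exists a, b; rewrite -hE subrr rpred0.
case: (ex_minnP exQ) => r /asboolP[a [b hab]] rmin.
exists r, a, b; split=> // c l cl1; apply/negP => cb.
case: r => [|r] in a b c l hab rmin cl1 cb *; first by case: (l).
suff /rmin : Q r by rewrite ltnn.
apply/asboolP; exists (fun j => a (lift l j) - c (lift l j) *: a l), (b \o lift l).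
have cbE : inx (a l) * iny (\sum_i c i *: b i) \in double_ideal s.
  by rewrite ideal_genM // iny_double.
move: hab cbE; rewrite !(bigD1_ord l) //= cl1 scale1r => hab cbE.
suff -> : \sum_j inx (a (lift l j) - c (lift l j) *: a l) * iny (b (lift l j)) =
    \sum_j inx (a (lift l j)) * iny (b (lift l j)) -
    inx (a l) * iny (\sum_j c (lift l j) *: b (lift l j)).
  have := rpredD hab cbE; set p := (X in X \in _ -> _); set q := (X in _ -> X \in _).
  by suff -> : p = q by []; rewrite /p /q rmorphD /=; ring.
rewrite linear_sum mulr_sumr -sumrB; apply: eq_bigr => j _.
by rewrite rmorphB /= mulrBl !linearZ /= -scalerAl -scalerAr.
Qed.

(** Separates b_l from the subspace W spanned by (s) and the other b_i, which does not contain b_l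
    by independence. *)
Lemma dual_functional r (b : 'I_r -> {mpoly k[n]}) :
    (forall (c : 'I_r -> k) l, c l = 1 -> \sum_i c i *: b i \notin ideal_gen s) ->
  forall l, exists phi : {scalar {mpoly k[n]}},
    (forall v, v \in ideal_gen s -> phi v = 0) /\
    (forall i, phi (b i) = (i == l)%:R).
Proof.
move=> indep l.
pose W v := exists2 c : 'I_r -> k, c l = 0 & v - \sum_i c i *: b i \in ideal_gen s.
have [|a x y [c cl0 xc] [d dl0 yd]||phi [phiW phi1]] := @separating_functional _ _ W (b l).
- exists (fun=> 0) => //; rewrite big1 ?subr0 ?rpred0 // => i _; exact: scale0r.
- exists (fun i => a * c i + d i); first by rewrite cl0 dl0 mulr0 addr0.
  have -> : \sum_i (a * c i + d i) *: b i = a *: (\sum_i c i *: b i) + \sum_i d i *: b i.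
    rewrite scaler_sumr -big_split; apply: eq_bigr => i _.
    by rewrite scalerDl scalerA.
  by rewrite opprD addrACA -scalerBr rpredD // -mul_mpolyC ideal_genM.
- case=> c cl0 blc.
  have /negP[] : \sum_i ((i == l)%:R - c i) *: b i \notin ideal_gen s.
    by apply: (indep _ l); rewrite cl0 eqxx subr0.
  under eq_bigr => i _ do rewrite scalerBl.
  rewrite sumrB (bigD1 l) //= eqxx scale1r (big1 _ (fun i => i != l)) ?addr0 //.
  by move=> i /negPf->; rewrite scale0r.
exists phi; split=> [v vs|i].
  apply: phiW; exists (fun=> 0) => //; rewrite big1 ?subr0 // => i _; exact: scale0r.
have [->//|il] := eqVneq; apply: phiW; exists (fun j => (j == i)%:R).
  by rewrite eq_sym (negPf il).
rewrite (bigD1 i) //= eqxx scale1r big1 ?addr0 ?subrr ?rpred0 //.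
by move=> j /negPf->; rewrite scale0r.
Qed.

Lemma annihilator_algebraic h j :
    h * (varx k j - vary k j) \in double_ideal s ->
  exists p : {poly k}, p \is monic /\
    inx (horner_alg ('X_j : {mpoly k[n]}) p) * h \in double_ideal s.
Proof.
move=> hxy; have [r [a [b [hab /dual_functional/choice[phi phiP]]]]] := reduced_tensor h.
pose M : 'M[k]_r := \matrix_(t, l) phi t ('X_j * b l).
pose ev : {rmorphism {poly k} -> {mpoly k[n]}} := horner_alg ('X_j : {mpoly k[n]}).
exists (char_poly M); split; first exact: char_poly_monic.
pose N : 'M[{mpoly k[n]}]_r := map_mx ev (char_poly_mx M).
have evM : ev (char_poly M) = \det N by rewrite -det_map_mx.
(* Contracting the sum of x_j a_l (x) b_l - a_l (x) x_j b_l with phi_t gives x_j a_t minus the sum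
   of the M_tl a_l, which is row t of N = x_j - M applied to the column a. By Cramer's rule det N,
   the characteristic polynomial of M at x_j, then kills every a_t modulo (s). *)
have Na t : \sum_l N t l * a l \in ideal_gen s.
  have [phi0 phib] := phiP t.
  have [Phi [PhiT PhiI]] := slice phi0.
  have : \sum_l (inx ('X_j * a l) * iny (b l) - inx (a l) * iny ('X_j * b l))
      \in double_ideal s.
    have -> : \sum_l (inx ('X_j * a l) * iny (b l) - inx (a l) * iny ('X_j * b l)) =
        (varx k j - vary k j) * \sum_l (inx (a l) * iny (b l)).
      rewrite mulr_sumr; apply: eq_bigr => l _.
      by rewrite !rmorphM /= inx_X iny_X; ring.
    set S := \sum_l _ in hab *.
    have -> : (varx k j - vary k j) * S =
      h * (varx k j - vary k j) - (varx k j - vary k j) * (h - S) by ring.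
    by rewrite rpredB // ideal_genM.
  move/PhiI; set p := (X in X \in _ -> _); set q := (X in _ -> X \in _).
  suff -> : p = q by []; rewrite /p /q; rewrite linear_sum; apply: eq_bigr => l _.
  rewrite linearB /= !PhiT phib !mxE rmorphB /= rmorphMn /=.
  rewrite /ev horner_algX horner_algC mulrBl.
  by rewrite mulr_algl eq_sym scaler_nat mulrnAl.
have da t : \det N * a t \in ideal_gen s.
  rewrite -adj_mul_col rpred_sum // => i _; exact: ideal_genM.
rewrite -/ev evM; rewrite -(subrK (\sum_l inx (a l) * iny (b l)) h) mulrDr.
apply: rpredD; first exact: ideal_genM.
rewrite mulr_sumr rpred_sum // => l _.
by rewrite mulrA -rmorphM mulrC ideal_genM // inx_double.
Qed.

End Finite.

(** Each monic polynomial splits, so a product of factors x_j - z lies in the ideal and one of them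
    can be adjoined while the ideal stays proper. Once this is done for all j, every h is congruent
    to the constant h(a), so a member with h(a) nonzero would make the ideal the unit ideal. *)
Lemma proper_ideal_zero (k : closedFieldType) n (s : seq {mpoly k[n]}) :
    1 \notin ideal_gen s ->
    (forall j, exists p : {poly k}, p \is monic /\
      horner_alg ('X_j : {mpoly k[n]}) p \in ideal_gen s) ->
  exists a : 'I_n -> k, forall h, h \in ideal_gen s -> h.@[a] = 0.
Proof.
move=> s1 s_alg.
have [t [t1 st xat]] : exists t : seq {mpoly k[n]},
    [/\ 1 \notin ideal_gen t, {subset s <= t} &
      forall j, j \in enum 'I_n -> exists a : k, 'X_j - a%:MP \in t].
  elim: (enum 'I_n) => [|j js [t [t1 st IHt]]]; first by exists s; split.
  have [p [p_monic /(ideal_gen_subset st)]] := s_alg j.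
  have [zs ->] := closed_field_poly_normal p.
  rewrite (monicP p_monic) scale1r rmorph_prod /=.
  under eq_bigr => z _ do rewrite rmorphB /= horner_algX horner_algC.
  rewrite -(big_map (fun z : k => 'X_j - z%:A) predT id).
  case/(ideal_gen_prod_split t1) => _ /mapP[a _ ->] t1'.
  exists ('X_j - a%:MP :: t); rewrite -[a%:MP]mulr1 mul_mpolyC.
  split=> //.
    by move=> x /st xt; rewrite inE xt orbT.
  move=> i; rewrite inE => /predU1P[->|/IHt[b bt]].
    by exists a; rewrite -[a%:MP]mulr1 mul_mpolyC mem_head.
  by exists b; rewrite inE bt orbT.
have [a aP] := choice (fun j => xat j (mem_enum _ j)).
exists a => h /(ideal_gen_subset st) ht; apply/eqP/negPn/negP => ha0.
move/negP: t1; apply.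
have /(_ h) : forall h, 1 * ((h \mPo [tuple 'X_j | j < n]) -
    (h \mPo [tuple (a j)%:MP_[n] | j < n])) \in ideal_gen t.
  by apply: comp_mpoly_congr => j; rewrite mul1r !tnth_mktuple mem_ideal_gen.
rewrite mul1r comp_mpoly_id.
have -> : h \mPo [tuple (a j)%:MP_[n] | j < n] = (h.@[a])%:MP.
  elim/mpoly_ring_ind: (h) => [c|i|p r Pp Pr|p r Pp Pr].
  - by rewrite comp_mpolyC mevalC.
  - by rewrite comp_mpolyXU -tnth_nth tnth_mktuple mevalXU.
  - by rewrite comp_mpolyD Pp Pr mevalD mpolyCD.
  by rewrite rmorphM /= Pp Pr mevalM mpolyCM.
move=> hha; rewrite -mpolyC1 -(mulVf ha0) mpolyCM ideal_genM //.
by rewrite -(subKr h (h.@[a])%:MP) rpredB.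
Qed.

Lemma horner_alg_morph (R : comNzRingType) (A B : comAlgType R)
    (phi : {lrmorphism A -> B}) a p :
  phi (horner_alg a p) = horner_alg (phi a) p.
Proof.
elim/poly_ind: p => [|p c IHp]; first by rewrite !rmorph0.
by rewrite !rmorphD !rmorphM /= IHp !horner_algX !horner_algC linearZ rmorph1.
Qed.

(** * Rational points of the fiber as prime ideals *)

Section VanishingIdeal.
Variables (k : fieldType) (n : nat) (a : 'I_n -> k).

Definition vanishing : {pred {mpoly k[n]}} := fun h => h.@[a] == 0.

Lemma vanishing_idealr : idealr_closed vanishing.
Proof.
split=> [||h u v]; rewrite /vanishing !unfold_in ?meval0 ?meval1 ?oner_eq0 //.
by move=> /eqP u0 /eqP v0; rewrite mevalD mevalM u0 v0 mulr0 addr0.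
Qed.

Lemma vanishing_prime : prime_idealr_closed vanishing.
Proof. by move=> u v; rewrite !unfold_in mevalM mulf_eq0. Qed.

HB.instance Definition _ := isIdealr.Build {mpoly k[n]} vanishing vanishing_idealr.
HB.instance Definition _ :=
  isPrimeIdealrClosed.Build {mpoly k[n]} vanishing vanishing_prime.

End VanishingIdeal.

(** The vanishing ideals of a and b both lie in the fiber, hence are equal; so x_j - b_j, which
    vanishes at b, vanishes at a. *)
Lemma injective_at_zeros (k : fieldType) n (f : n.-tuple {mpoly k[n]})
    (q : n.-tuple k) (a b : 'I_n -> k) :
    injective_at f q ->
    (forall u, u \in sub_point f q -> u.@[a] = 0) ->
    (forall u, u \in sub_point f q -> u.@[b] = 0) ->
  a =1 b.
Proof.
move=> f_inj a0 b0 j.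
have /f_inj ab : in_fiber f q (vanishing a).
  by move=> i; apply/eqP/a0; rewrite mem_tnth.
have /ab/(_ ('X_j - (b j)%:MP)) : in_fiber f q (vanishing b).
  by move=> i; apply/eqP/b0; rewrite mem_tnth.
rewrite !unfold_in !mevalB !mevalXU !mevalC subrr eqxx subr_eq0.
by move/eqP.
Qed.

(** * The Bezoutian near and on the diagonal *)

Section Bezoutian.
Variables (k : fieldType) (n : nat) (f : n.-tuple {mpoly k[n]}).

(** The sum over l of Delta_il (x_l - y_l) telescopes to f_i(x) - f_i(y), which lies in the ideal;
    Cramer's rule passes from these sums to the determinant. *)
Lemma bezoutian_annihilates j :
  bezoutian f * (varx k j - vary k j) \in double_ideal f.
Proof.
pose D := \matrix_(i < n, j < n) bez_quot f i j.
have mixed0 : mixed k n 0 = [tuple varx k l | l < n].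
  by apply: eq_from_tnth => l; rewrite !tnth_mktuple.
have mixedn : mixed k n n = [tuple vary k l | l < n].
  by apply: eq_from_tnth => l; rewrite !tnth_mktuple ltn_ord.
pose w (l : 'I_n) := varx k l - vary k l.
have Dw i : \sum_l D i l * w l = inx (tnth f i) - iny (tnth f i).
  transitivity (\sum_(l < n) ((tnth f i \mPo mixed k n l) - (tnth f i \mPo mixed k n l.+1))).
    by apply: eq_bigr => l _; rewrite mxE bez_quotP.
  rewrite -(big_mkord predT (fun l => (tnth f i \mPo mixed k n l) - (tnth f i \mPo mixed k n l.+1))).
  under eq_bigr => l _ do rewrite -opprB.
  rewrite sumrN telescope_sumr // opprB.
  by rewrite mixed0 mixedn.
rewrite /bezoutian -/D -[_ - _]/(w j) -adj_mul_col.
apply: rpred_sum => i _; rewrite ideal_genM // Dw.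
by rewrite rpredB ?inx_double ?iny_double ?mem_ideal_gen ?mem_tnth.
Qed.

(** Differentiate the identity defining Delta_ij with respect to x_j and set x = y. On the left only
    Delta_ij survives, since x_j - y_j vanishes; on the right the first term gives the partial
    derivative of f_i, and the second does not involve x_j. *)
Lemma diag_bezoutian : diag (bezoutian f) = jacobian f.
Proof.
rewrite /bezoutian /jacobian -det_map_mx; congr (\det _).
apply/matrixP => i j; rewrite !mxE.
have diag_mixed m u : diag (u \mPo mixed k n m) = u.
  rewrite /diag comp_mpolyA -[RHS]comp_mpoly_id; congr (_ \mPo _).
  apply: eq_from_tnth => l; rewrite !tnth_mktuple.
  by case: ifP => _; [exact: diag_vary | exact: diag_varx].
have := congr1 (fun h => diag (h^`M(lshift n j))) (bez_quotP f i j).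
rewrite mderivM !mderivB !mderivXU eqxx eq_rlshift subr0 mulr1 !mderiv_comp.
rewrite rmorphD rmorphM !rmorphB /= diag_varx diag_vary subrr mulr0 add0r => ->.
rewrite !rmorph_sum /= [X in _ - X]big1 ?subr0 => [|l _].
  rewrite (bigD1 j) //= big1 ?addr0 => [|l lj].
    by rewrite rmorphM /= diag_mixed tnth_mktuple ltnn mderivXU eqxx rmorph1 mulr1.
  rewrite rmorphM /= tnth_mktuple; case: ifP => _; rewrite mderivXU ?eq_rlshift ?eq_lshift.
    by rewrite rmorph0 mulr0.
  by rewrite (negPf lj) rmorph0 mulr0.
rewrite rmorphM /= tnth_mktuple ltnS; case: ifP => lj; rewrite mderivXU ?eq_rlshift ?eq_lshift.
  by rewrite rmorph0 mulr0.
by rewrite -val_eqE gtn_eqF ?rmorph0 ?mulr0 // ltnNge lj.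
Qed.

Lemma jacobian_sub_point q : jacobian (sub_point f q) = jacobian f.
Proof.
congr (\det _); apply/matrixP => i j.
by rewrite !mxE tnth_mktuple mderivB mderivC subr0.
Qed.

End Bezoutian.

(** * Constancy of the reduced Bezoutian *)

Theorem lemma4p5 (k : closedFieldType) (char0 : [pchar k] =i pred0) (n : nat)
    (f : n.-tuple {mpoly k[n]}) (q : n.-tuple k)
    (jac_unit : exists2 c : k, c != 0 & jacobian f = c%:MP)
    (f_inj : injective_at f q) :
  is_constant (reduced_bezoutian (sub_point f q)).
Proof.
have [c c0] := jac_unit; rewrite -(jacobian_sub_point f q).
pose g := sub_point f q; rewrite -/g => jac_c.
pose B := bezoutian g; pose I := double_ideal g.
have diagB : diag B = c%:MP by rewrite /B diag_bezoutian.
have Bw j : B * (varx k j - vary k j) \in I by exact: bezoutian_annihilates.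
(* On the diagonal B becomes the nonzero constant c, so p(x_j) B in I restricts to c p(x_j) in (g),
   and c can be divided out. *)
have alg j : exists p : {poly k}, p \is monic /\
    horner_alg ('X_j : {mpoly k[n]}) p \in ideal_gen g.
  have [p [p_monic /diag_double]] := annihilator_algebraic (Bw j).
  rewrite rmorphM /= diag_inx diagB => pc; exists p; split=> //.
  set u := horner_alg _ _ in pc *.
  rewrite -[u]mul1r -mpolyC1 -(mulVf c0) mpolyCM -mulrA [_ * u]mulrC.
  exact: ideal_genM.
(* B kills x_j - y_j modulo I, hence h - h(y, y) for every polynomial h; this is the case h = B,
   where B(y, y) = c. *)
have BB : B * (B - c%:MP) \in I.
  have := @comp_mpoly_congr _ _ _ _ B [tuple 'X_i | i < n + n]
    [tuple iny (diag 'X_i) | i < n + n] _ B.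
  rewrite comp_mpoly_id.
  rewrite -iny_diag diagB [iny _]comp_mpolyC; apply => i; rewrite !tnth_mktuple.
  case: (split_ordP i) => j ->.
    by rewrite -/(varx k j) diag_varx iny_X; exact: Bw.
  by rewrite -/(vary k j) diag_vary iny_X subrr mulr0 rpred0.
have [I1|I1] := boolP (1 \in I).
  right; split=> //; rewrite /reduced_bezoutian -[RHS]pi_zeror.
  apply/eqP; rewrite -Quotient.idealrBE subr0 -[X in X \in _]mulr1.
  exact: ideal_genM.
left; split=> //; exists c; apply/eqP; rewrite -Quotient.idealrBE -/B.
(* If (B) + I were proper, the monic polynomials of [alg], read in x and in y, would give it a zero
   in 2n coordinates. Its two halves are zeros of g, hence equal, so B takes the value c there,
   contradicting B = 0. *)
have : 1 \in ideal_gen (B :: map (@inx k n) g ++ map (@iny k n) g).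
  apply/negPn/negP => J1.
  have JI h : h \in I -> h \in ideal_gen (B :: map (@inx k n) g ++ map (@iny k n) g).
    by apply: ideal_gen_subset => x sx; rewrite inE sx orbT.
  have [i|a aJ] := proper_ideal_zero J1.
    case: (split_ordP i) => j ->; have [p [p_monic pg]] := alg j; exists p; split=> //.
      by rewrite -/(varx k j) -inx_X -horner_alg_morph JI ?inx_double.
    by rewrite -/(vary k j) -iny_X -horner_alg_morph JI ?iny_double.
  have ax u : u \in g -> u.@[fun j => a (lshift n j)] = 0.
    move=> ug; rewrite -(aJ (inx u)) ?JI ?inx_double ?mem_ideal_gen //.
    rewrite /inx comp_mpoly_meval; apply: meval_eq => j.
    by rewrite tnth_mktuple mevalXU.
  have ay u : u \in g -> u.@[fun j => a (rshift n j)] = 0.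
    move=> ug; rewrite -(aJ (iny u)) ?JI ?iny_double ?mem_ideal_gen //.
    rewrite /iny comp_mpoly_meval; apply: meval_eq => j.
    by rewrite tnth_mktuple mevalXU.
  have axy := injective_at_zeros f_inj ax ay.
  move/negP: c0; apply; apply/eqP.
  rewrite -(mevalC (fun j => a (lshift n j)) c) -diagB.
  rewrite -(aJ B) ?mem_ideal_gen ?mem_head // /diag comp_mpoly_meval.
  apply: meval_eq => i; rewrite tnth_mktuple mevalXU.
  by case: (split_ordP i) => j -> //; rewrite axy.
case/ideal_gen_consP => r rB.
(* Both summands lie in I: the first because 1 - r B does, the second by [BB]. *)
have -> : B - c%:MP = (B - c%:MP) * (1 - r * B) + r * (B * (B - c%:MP)) by ring.
by rewrite rpredD // ideal_genM.
Qed.
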